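(* Let $H=K_{k_1}\Box\cdots\Box K_{k_n}$ and let $G$ be an isometric daisy graph of $H$ with respect to $0^n$, where $H$ is the smallest possible. Then there exists a daisy graph $G'$ (of a Hamming graph with one factor fewer, with respect to its all-zero vertex), isomorphic to a subgraph of $G$, such that $G$ is obtained (up to isomorphism) from $G'$ by a daisy peripheral expansion.
   Context: $V(H)=\prod_{i=1}^n\{0,\dots,k_i-1\}$, vertices adjacent iff they differ in exactly one coordinate. For a Hamming graph $K$ with all-zero vertex $0$ and $X\subseteq V(K)$, the daisy graph $K_0(X)$ is the subgraph of $K$ induced by $\bigcup_{v\in X}I_K(0,v)$ ($I_K(a,b)$: vertices on shortest $a,b$-paths); isometric means distance-preserving. ''$H$ is the smallest possible'' means $G$ is not such a daisy graph of a Hamming graph with fewer or smaller factors. Expansion (Chepoi): for a connected graph $G'$ and subsets $W_0,\dots,W_l$ of $V(G')$ with pairwise nonempty intersections, union $V(G')$, no edges between $W_i\setminus W_j$ and $W_j\setminus W_i$, and all $\langle W_i\rangle$, $\langle W_i\cup W_j\rangle$ isometric in $G'$, the expansion replaces each vertex $x$ by a clique on vertices $x_i$ (one for each $i$ with $x\in W_i$) and joins $x_iy_i$ whenever $xy\in E(G')$ and $x,y\in W_i$. It is peripheral if some $W_i=V(G')$. If $G'$ is a daisy graph of a Hamming graph $K$ with respect to its all-zero vertex, a peripheral expansion relative to $W_0=V(G'),W_1,\dots,W_l$ is a daisy peripheral expansion if each $\langle W_i\rangle_K$ ($1\le i\le l$) is a daisy graph of $K$ with respect to the all-zero vertex. 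*)

(* Defs.v *)
From HB Require Import structures.
From mathcomp Require Import all_boot.

Set Implicit Arguments.
Unset Strict Implicit.
Unset Printing Implicit Defensive.

Record sgraph := SGraph {
  svertex :> finType;
  adj : rel svertex;
  adj_sym : symmetric adj;
  adj_irr : irreflexive adj }.

Definition connected (G : sgraph) : Prop := forall x y : G, connect (@adj G) x y.

Definition iso (G H : sgraph) : Prop :=
  exists2 f : G -> H, bijective f & forall x y, adj (f x) (f y) = adj x y.

(* As in path.v, a walk a, p_1, ..., p_r is given by its start a and the
   sequence p of its remaining vertices; its length is size p. *)
Definition walk (G : sgraph) (a b : G) (p : seq G) : Prop :=
  path (@adj G) a p /\ last a p = b.

Definition shortest_path (G : sgraph) (a b : G) (p : seq G) : Prop :=
  walk a b p /\ forall q, walk a b q -> size p <= size q.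

(* A relation rather than a function, so that vertices in different
   components are at no (finite) distance. *)
Definition is_dist (G : sgraph) (a b : G) (d : nat) : Prop :=
  exists2 p, shortest_path a b p & size p = d.

Definition in_interval (G : sgraph) (a b x : G) : Prop :=
  exists2 p, shortest_path a b p & x \in a :: p.

Section Subgraphs.
Variable G : sgraph.

Section Induced.
Variable A : {set G}.
Definition induced_adj : rel {x : G | x \in A} :=
  fun x y => adj (val x) (val y).
Fact induced_sym : symmetric induced_adj.
Proof. by move=> x y; apply: adj_sym. Qed.
Fact induced_irr : irreflexive induced_adj.
Proof. by move=> x; apply: adj_irr. Qed.
Definition induced : sgraph := SGraph induced_sym induced_irr.
End Induced.

Definition isometric (A : {set G}) : Prop :=
  forall (x y : induced A) (d : nat),
    is_dist x y d <-> is_dist (val x) (val y) d.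

Record subgraph := Subgraph {
  sub_vertices : {set G};
  sub_edge : rel G;
  sub_edge_sym : symmetric sub_edge;
  sub_edgeP : forall x y, sub_edge x y ->
    [/\ x \in sub_vertices, y \in sub_vertices & adj x y] }.

Section SubgraphAsGraph.
Variable S : subgraph.
Definition subgraph_adj : rel {x : G | x \in sub_vertices S} :=
  fun x y => sub_edge S (val x) (val y).
Fact subgraph_sym : symmetric subgraph_adj.
Proof. by move=> x y; apply: sub_edge_sym. Qed.
Fact subgraph_irr : irreflexive subgraph_adj.
Proof. by move=> x; apply/negP => /sub_edgeP[_ _]; rewrite adj_irr. Qed.
Definition sgraph_of_subgraph : sgraph := SGraph subgraph_sym subgraph_irr.
End SubgraphAsGraph.

(* A is the vertex set of the daisy graph G_z(X) for some X. *)
Definition daisy (z : G) (A : {set G}) : Prop :=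
  exists X : {set G},
    forall x, x \in A <-> exists2 v, v \in X & in_interval z v x.

End Subgraphs.

Definition iso_to_subgraph (F G : sgraph) : Prop :=
  exists S : subgraph G, iso F (sgraph_of_subgraph S).

Section Hamming.
Variables (n : nat) (k : 'I_n -> nat).

Definition hamming_vertex : finType := {dffun forall i : 'I_n, 'I_(k i)}.
Definition hamming_adj : rel hamming_vertex :=
  fun x y => #|[set i | x i != y i]| == 1.
Fact hamming_sym : symmetric hamming_adj.
Proof.
by move=> x y; congr (_ == _); apply: eq_card => i; rewrite !inE eq_sym.
Qed.
Fact hamming_irr : irreflexive hamming_adj.
Proof.
move=> x; rewrite /hamming_adj eq_card0 // => i.
by rewrite !inE eqxx.
Qed.
Definition hamming : sgraph := SGraph hamming_sym hamming_irr.

Definition zero_vertex (k_gt0 : forall i, 0 < k i) : hamming :=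
  [ffun i => Ordinal (k_gt0 i)].
End Hamming.

Section IsometricDaisy.
Variables (n : nat) (k : 'I_n -> nat) (k_gt0 : forall i, 0 < k i).

Definition hamming_daisy (A : {set hamming k}) : Prop :=
  daisy (zero_vertex k_gt0) A.

Definition isometric_daisy (A : {set hamming k}) : Prop :=
  hamming_daisy A /\ isometric A.
End IsometricDaisy.

Definition realizable (n : nat) (k : 'I_n -> nat) (G : sgraph) : Prop :=
  exists (k_gt0 : forall i, 0 < k i) (B : {set hamming k}),
    isometric_daisy k_gt0 B /\ iso G (induced B).

(* Neither fewer factors (of whatever sizes), nor as many factors, none larger
   and at least one strictly smaller, suffice to realize G.  The empty product
   (m = 0) is the one-vertex Hamming graph. *)
Definition smallest_hamming (n : nat) (k : 'I_n -> nat) (G : sgraph) : Prop :=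
  (forall (m : nat) (k' : 'I_m -> nat), m < n -> ~ realizable k' G) /\
  (forall k' : 'I_n -> nat,
     (forall i, k' i <= k i) -> (exists i, k' i < k i) -> ~ realizable k' G).

Section Expansion.
Variables (G : sgraph) (l : nat) (W : 'I_l.+1 -> {set G}).

Record expansion_family : Prop := ExpansionFamily {
  exp_connected : connected G;
  exp_meet : forall i j, i != j -> W i :&: W j != set0;
  exp_cover : \bigcup_i W i = [set: G];
  exp_no_edge : forall i j x y,
    x \in W i :\: W j -> y \in W j :\: W i -> ~~ adj x y;
  exp_isometric : forall i, isometric (W i);
  exp_isometricU : forall i j, isometric (W i :|: W j) }.

(* The vertex (x, i) is the copy x_i of x. *)
Definition expansion_adj : rel {p : G * 'I_l.+1 | p.1 \in W p.2} :=
  fun p q => let: (x, i) := val p in let: (y, j) := val q in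
    ((x == y) && (i != j)) || ((i == j) && adj x y).
Fact expansion_sym : symmetric expansion_adj.
Proof.
move=> [[x i] /= hp] [[y j] /= hq]; rewrite /expansion_adj /=.
by rewrite [x == y]eq_sym [i == j]eq_sym adj_sym.
Qed.
Fact expansion_irr : irreflexive expansion_adj.
Proof.
by move=> [[x i] /= hp]; rewrite /expansion_adj /= !eqxx adj_irr.
Qed.
Definition expansion : sgraph := SGraph expansion_sym expansion_irr.
End Expansion.

Section DaisyExpansion.
Variables (n : nat) (k : 'I_n -> nat) (k_gt0 : forall i, 0 < k i).
Variables (A : {set hamming k}) (l : nat) (W : 'I_l.+1 -> {set induced A}).

(* The sets W i consist of vertices of <A>; val @: W i is the same set seen in
   the ambient Hamming graph. *)
Record daisy_peripheral_expansion : Prop := DaisyPeripheralExpansion {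
  dpe_daisy : hamming_daisy k_gt0 A;
  dpe_family : expansion_family W;
  dpe_peripheral : W ord0 = [set: induced A];
  dpe_sets : forall i, i != ord0 -> hamming_daisy k_gt0 (val @: W i) }.
End DaisyExpansion.

(* Main.v *)
Require Import Defs.
From mathcomp Require Import all_boot zify.

(** Fix one coordinate and let [W_j] be the layer of [A] at height [j], viewed
    in the Hamming graph with that coordinate deleted.  Since [A] is closed
    under passing to intervals from [0], every layer sits inside [A' := W_0]
    and is itself a daisy graph, and [A] is the expansion of [A'] along its
    layers.  A set of vertices of a Hamming graph is isometric iff any two of
    its points admit a first geodesic step inside the set; this local criterion
    passes from [A] to each [W_i] and to each union of two layers.  It also
    rules out edges between [W_i \ W_j] and [W_j \ W_i], because two vertices
    differing in exactly two coordinates have only two common neighbours.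
    Minimality of the Hamming graph makes every layer nonempty: an unused value
    could be removed from its factor, and a one-vertex factor dropped. *)

Set Implicit Arguments.
Unset Strict Implicit.
Unset Printing Implicit Defensive.

(** * Bijections and isomorphisms *)

Lemma inj_surj_bij (T U : finType) (f : T -> U) :
  injective f -> (forall y, exists x, f x = y) -> bijective f.
Proof.
move=> f_inj f_surj.
have ex y : exists x, f x == y by have [x <-] := f_surj y; exists x.
have gK : cancel (fun y => xchoose (ex y)) f.
  by move=> y; apply/eqP/(xchooseP (ex y)).
by exists (fun y => xchoose (ex y)) => // x; apply: f_inj; rewrite gK.
Qed.

Lemma iso_sym (G H : sgraph) : iso G H -> iso H G.
Proof.
case=> f [g fK gK] f_adj; exists g; first by exists f.
by move=> x y; rewrite -f_adj !gK.
Qed.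

(** * Graph metrics *)

(** These conditions force [d] to be the path distance: the triangle inequality bounds every walk
    from below, and iterating [gm_step] yields a walk of length [d x y]. *)
Record graph_metric (G : sgraph) (d : G -> G -> nat) : Prop := GraphMetric {
  gm_eq0 : forall x y, d x y = 0 -> x = y;
  gm_refl : forall x, d x x = 0;
  gm_triangle : forall y x z, d x z <= d x y + d y z;
  gm_adj : forall x y, adj x y = (d x y == 1);
  gm_step : forall x y, 0 < d x y ->
    exists2 z, d x z = 1 & (d z y).+1 = d x y }.

Definition geodesic_set (G : sgraph) (d : G -> G -> nat) (S : {set G}) : Prop :=
  forall x y, x \in S -> y \in S -> 0 < d x y ->
    exists z, [/\ z \in S, d x z = 1 & (d z y).+1 = d x y].

(** The equation places [x] in the interval from [o] to [v], so this is the metric form of being a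
    daisy graph at [o]. *)
Definition star_closed (G : sgraph) (d : G -> G -> nat) (o : G) (S : {set G}) :=
  forall v x, v \in S -> d o x + d x v = d o v -> x \in S.

Section GraphMetric.
Variables (G : sgraph) (d : G -> G -> nat).
Hypothesis dG : graph_metric d.

Lemma gm_walk_le x y p : walk x y p -> d x y <= size p.
Proof.
case; elim: p x => [|z p IHp] x /=; first by move=> _ <-; rewrite (gm_refl dG).
rewrite (gm_adj dG) => /andP[/eqP xz zp] lastp.
by have := IHp z zp lastp; have := gm_triangle dG z x y; lia.
Qed.

Lemma gm_walk x y : exists2 p, walk x y p & size p = d x y.
Proof.
move def_m: (d x y) => m; elim: m x def_m => [|m IHm] x dxy.
  by exists [::] => //; split => //=; apply: (gm_eq0 dG).
have /(gm_step dG)[z xz] : 0 < d x y by rewrite dxy.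
rewrite dxy => -[/IHm[p [zp lastp] <-]].
by exists (z :: p) => //; split; rewrite //= (gm_adj dG) xz.
Qed.

Lemma gm_shortestP x y p :
  shortest_path x y p <-> walk x y p /\ size p = d x y.
Proof.
split=> [[xyp p_min]|[xyp p_d]]; split=> //; last first.
  by move=> q /gm_walk_le; rewrite p_d.
have [q /p_min pq dq] := gm_walk x y.
by have := gm_walk_le xyp; lia.
Qed.

Lemma gm_is_dist x y m : is_dist x y m <-> m = d x y.
Proof.
split=> [[p /gm_shortestP[_ ->] ->]//|->].
by have [p xyp dp] := gm_walk x y; exists p => //; apply/gm_shortestP.
Qed.

Lemma gm_in_interval a b x : in_interval a b x <-> d a x + d x b = d a b.
Proof.
split=> [[p /gm_shortestP[[ap lastp] dp] xp]|dx].
  case/splitPl: xp ap lastp dp => p1 p2 last1.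
  rewrite cat_path last_cat size_cat last1.
  case/andP=> ap1 xp2 lastp dp.
  have := gm_walk_le (conj ap1 last1); have := gm_walk_le (conj xp2 lastp).
  by have := gm_triangle dG x a b; lia.
have [p [ap lastp] dp] := gm_walk a x; have [q [xq lastq] dq] := gm_walk x b.
exists (p ++ q); last by rewrite -cat_cons mem_cat -lastp mem_last.
apply/gm_shortestP; rewrite size_cat dp dq; split=> //.
by split; rewrite ?cat_path ?last_cat lastp ?ap.
Qed.

Lemma gm_connected : connected G.
Proof.
by move=> x y; have [p [xp lastp] _] := gm_walk x y; apply/connectP; exists p.
Qed.

Lemma gm_induced (S : {set G}) : geodesic_set d S ->
  @graph_metric (induced S) (fun x y => d (val x) (val y)).
Proof.
move=> geoS; split=> [x y /(gm_eq0 dG)/val_inj//|x|y x z|x y|x y dxy].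
- exact: gm_refl dG _.
- exact: gm_triangle dG _ _ _.
- exact: gm_adj dG _ _.
have [z [zS xz zy]] := geoS _ _ (valP x) (valP y) dxy.
by exists (exist _ z zS).
Qed.

End GraphMetric.

Section GeodesicSets.
Variables (G : sgraph) (d : G -> G -> nat).
Hypothesis dG : graph_metric d.

(** Forward, the first vertex of a shortest path inside [S] is the required step. Backward, [d]
    restricted to [S] is itself the path distance of the induced graph, so both distances equal
    [d]. *)
Lemma isometric_geodesic (S : {set G}) : isometric S <-> geodesic_set d S.
Proof.
split=> [isoS x y xS yS dxy|geoS x y m]; last first.
  by rewrite (gm_is_dist dG) (gm_is_dist (gm_induced dG geoS)).
pose u : induced S := exist _ x xS; pose v : induced S := exist _ y yS.
have /isoS[p [[up lastp] _] dp] : is_dist (val u) (val v) (d x y).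
  by apply/(gm_is_dist dG).
case: p up lastp dp => [|z p] /=; first by move=> _ _ /= d0; rewrite -d0 in dxy.
case/andP=> uz zp lastp dp; exists (val z); split; first exact: (valP z).
  by apply/eqP; rewrite -(gm_adj dG).
have zy : walk (val z) y (map val p).
  split; last by rewrite last_map lastp.
  by rewrite path_map.
have p_d : (size p).+1 = d x y := dp.
have z_le : d (val z) y <= size p.
  by rewrite -[size p](size_map val); apply: gm_walk_le zy.
have /eqP xz : d x (val z) == 1 by rewrite -(gm_adj dG).
have xy_le := gm_triangle dG (val z) x y.
rewrite xz add1n in xy_le.
by apply/eqP; rewrite eqn_leq xy_le -p_d ltnS z_le.
Qed.

(** Intervals from [o] nest: if [v] lies between [o] and [w], so does all that lies between [o] and
    [v]. Conversely [S] serves as its own generating set. *)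
Lemma daisy_star_closed (o : G) (S : {set G}) : daisy o S <-> star_closed d o S.
Proof.
split=> [[X SX] v x /SX[w wX /(gm_in_interval dG) ov] ox|closedS].
  apply/SX; exists w => //; apply/(gm_in_interval dG).
  by have := gm_triangle dG v x w; have := gm_triangle dG x o w; lia.
exists S => x; split=> [xS|[v vS /(gm_in_interval dG)]]; last exact: closedS.
by exists x => //; apply/(gm_in_interval dG); rewrite (gm_refl dG) addn0.
Qed.

End GeodesicSets.

Lemma isometric_in_induced (G : sgraph) (d : G -> G -> nat) (S : {set G})
    (W : {set induced S}) :
  graph_metric d -> geodesic_set d S -> geodesic_set d (val @: W) -> isometric W.
Proof.
move=> dG geoS geoW; apply/(isometric_geodesic (gm_induced dG geoS)) => x y xW yW.
case/(geoW _ _ (imset_f val xW) (imset_f val yW)) => _ [/imsetP[z zW ->] xz zy].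
by exists z.
Qed.

(** * The Hamming distance *)

Section HammingDistance.
Variables (n : nat) (k : 'I_n -> nat).
Implicit Types x y z : hamming_vertex k.

Definition hdist (x y : hamming k) : nat :=
  \sum_(i < n) ((x : hamming_vertex k) i != (y : hamming_vertex k) i :> nat).

Lemma hdist_adj x y : hamming_adj x y = (hdist x y == 1).
Proof.
by rewrite /hamming_adj -sum1dep_card big_mkcond.
Qed.

Lemma hdist_metric : graph_metric hdist.
Proof.
split=> [x y|x|y x z|x y|x y].
- move/eqP; rewrite sum_nat_eq0 => /forallP xy; apply/ffunP => i.
  by apply: val_inj; have /= := xy i; rewrite eqb0 negbK => /eqP.
- by rewrite /hdist big1 // => i _; rewrite eqxx.
- rewrite /hdist -big_split /=; apply: leq_sum => i _.
  by case: (eqVneq (x i : nat) (y i)) => [->|_]; [|case: (_ != _)].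
- exact: hdist_adj.
rewrite lt0n sum_nat_eq0 negb_forall => /existsP[c /=]; rewrite eqb0 negbK => xyc.
(* Correct one coordinate [c] where [x] and [y] differ. *)
exists [ffun i => if i == c then y i else x i].
  rewrite /hdist (bigD1 c) //= ffunE eqxx xyc big1 // => i /negPf ic.
  by rewrite ffunE ic eqxx.
rewrite /hdist (bigD1 c) //= ffunE eqxx eqxx add0n [RHS](bigD1 c) //= xyc.
by rewrite add1n; congr _.+1; apply: eq_bigr => i /negPf ic; rewrite ffunE ic.
Qed.

Lemma hdist0_eq x y : hdist x y = 0 -> x = y.
Proof. exact: gm_eq0 hdist_metric _ _. Qed.

Lemma hdistxx x : hdist x x = 0.
Proof. exact: gm_refl hdist_metric _. Qed.

Variable k_gt0 : forall i, 0 < k i.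

Lemma isometric_daisyP (A : {set hamming k}) : isometric_daisy k_gt0 A <->
  star_closed hdist (zero_vertex k_gt0) A /\ geodesic_set hdist A.
Proof.
rewrite /isometric_daisy /hamming_daisy (daisy_star_closed hdist_metric).
by rewrite (isometric_geodesic hdist_metric).
Qed.

(* Entries out of range are replaced by 0. *)
Definition hvertex (f : 'I_n -> nat) : hamming_vertex k :=
  [ffun i => insubd (Ordinal (k_gt0 i)) (f i)].

Lemma hvertexE f i : f i < k i -> hvertex f i = f i :> nat.
Proof. by move=> fi; rewrite ffunE val_insubd fi. Qed.

Lemma zero_vertexE i : (zero_vertex k_gt0 : hamming_vertex k) i = 0 :> nat.
Proof. by rewrite ffunE. Qed.

Lemma hvertex_ext x y : (forall i, x i = y i :> nat) -> x = y.
Proof. by move=> xy; apply/ffunP => i; apply/val_inj/xy. Qed.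

End HammingDistance.

(** The preimage of [A] under a distance-preserving map that fixes zero and covers [A] is again an
    isometric daisy graph, isomorphic to [A]. Minimality is contradicted through such maps from
    smaller Hamming graphs. *)
Lemma realizable_pullback n (k : 'I_n -> nat) (k_gt0 : forall i, 0 < k i)
    m (h : 'I_m -> nat) (h_gt0 : forall i, 0 < h i)
    (f : hamming h -> hamming k) (A : {set hamming k}) :
  (forall x y, hdist (f x) (f y) = hdist x y) ->
  f (zero_vertex h_gt0) = zero_vertex k_gt0 ->
  (forall x, x \in A -> exists y, f y = x) ->
  isometric_daisy k_gt0 A -> realizable h (induced A).
Proof.
move=> f_dist f0 f_surj /isometric_daisyP[starA geoA].
exists h_gt0, (f @^-1: A); split.
  apply/isometric_daisyP; split=> [v x|x y].
    by rewrite !inE => vA ox; apply: starA vA _; rewrite -f0 !f_dist.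
  rewrite !inE -f_dist => xA yA /(geoA _ _ xA yA)[z [zA]].
  have [w def_z] := f_surj z zA; rewrite -def_z !f_dist => xw wy.
  by exists w; rewrite inE def_z.
have fA (x : induced (f @^-1: A)) : f (val x) \in A.
  by have := valP x; rewrite inE.
apply: iso_sym; exists (fun x => exist _ (f (val x)) (fA x) : induced A).
  apply: inj_surj_bij => [x y [fxy]|x].
    by apply/val_inj/hdist0_eq; rewrite -f_dist fxy hdistxx.
  have [y fy] := f_surj _ (valP x).
  have yA : y \in f @^-1: A by rewrite inE fy (valP x).
  by exists (exist _ y yA); apply: val_inj.
by move=> x y; rewrite /= /induced_adj /= !hdist_adj f_dist.
Qed.

(** * Layers along the first coordinate *)

Section Layers.
Variables (n : nat) (k : 'I_n.+1 -> nat) (k_gt0 : forall i, 0 < k i).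

Definition tail_dims (i : 'I_n) : nat := k (lift ord0 i).

Lemma tail_dims_gt0 i : 0 < tail_dims i.
Proof. exact: k_gt0. Qed.

Definition hcons (j : nat) (x : hamming tail_dims) : hamming k :=
  hvertex k_gt0 (fun i =>
    if unlift ord0 i is Some i' then (x : hamming_vertex tail_dims) i' : nat
    else j).

Definition htail (x : hamming k) : hamming tail_dims :=
  [ffun i : 'I_n => (x : hamming_vertex k) (lift ord0 i)].

Lemma hcons0E j x : j < k ord0 -> (hcons j x : hamming_vertex k) ord0 = j :> nat.
Proof. by move=> jk; rewrite hvertexE unlift_none. Qed.

Lemma hconsSE j x i :
  (hcons j x : hamming_vertex k) (lift ord0 i)
    = (x : hamming_vertex tail_dims) i :> nat.
Proof. by rewrite hvertexE liftK ?ltn_ord. Qed.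

Lemma hcons_tail (x : hamming k) :
  hcons ((x : hamming_vertex k) ord0) (htail x) = x.
Proof.
apply: hvertex_ext => i; case: (unliftP ord0 i) => [i'|] ->.
  by rewrite hconsSE ffunE.
by rewrite hcons0E.
Qed.

Lemma hdist_cons i j x y : i < k ord0 -> j < k ord0 ->
  hdist (hcons i x) (hcons j y) = (i != j) + hdist x y.
Proof.
move=> ik jk; rewrite /hdist big_ord_recl !hcons0E //; congr (_ + _).
by apply: eq_bigr => c _; rewrite !hconsSE.
Qed.

Lemma hcons_zero : hcons 0 (zero_vertex tail_dims_gt0) = zero_vertex k_gt0.
Proof.
apply: hvertex_ext => i; rewrite zero_vertexE.
case: (unliftP ord0 i) => [i'|] ->; last by rewrite hcons0E.
by rewrite hconsSE zero_vertexE.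
Qed.

Variable A : {set hamming k}.
Hypothesis starA : star_closed (@hdist _ k) (zero_vertex k_gt0) A.
Hypothesis geoA : geodesic_set (@hdist _ k) A.

Definition layer (j : nat) : {set hamming tail_dims} := [set x | hcons j x \in A].

Lemma layer_star_closed j : j < k ord0 ->
  star_closed (@hdist _ tail_dims) (zero_vertex tail_dims_gt0) (layer j).
Proof.
move=> jk v x; rewrite !inE => vA ox; apply: starA vA _.
by rewrite -hcons_zero !hdist_cons // eqxx; lia.
Qed.

(** Lowering the first coordinate to 0 gives a vertex on a geodesic to the zero vertex. *)
Lemma layer_sub0 j : j < k ord0 -> layer j \subset layer 0.
Proof.
move=> jk; apply/subsetP => x; rewrite !inE => xA; apply: starA xA _.
by rewrite -hcons_zero !hdist_cons // hdistxx eqxx; lia.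
Qed.

(** If the step that [A] offers from height [i] changes only the height, it must reach height [j].
    The step is then retaken from there, where a change of height can no longer shorten the
    distance. *)
Lemma geodesic_layers i j : i < k ord0 -> j < k ord0 ->
  forall x y, x \in layer i -> y \in layer j -> 0 < hdist x y ->
    exists z, [/\ z \in layer i :|: layer j, hdist x z = 1
                & (hdist z y).+1 = hdist x y].
Proof.
move=> ik jk x y xi yj xy.
suff [c [z [/orP cij zc xz zy]]] : exists c z,
    [/\ (c == i) || (c == j), z \in layer c, hdist x z = 1
      & (hdist z y).+1 = hdist x y].
  exists z; split=> //; rewrite inE.
  by case: cij => /eqP <-; rewrite zc ?orbT.
(* A geodesic step from a copy of x in layer a either stays in layer a, or
   lands on the copy of x in layer j. *)
have step a : a < k ord0 -> x \in layer a ->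
    (exists z, [/\ z \in layer a, hdist x z = 1 & (hdist z y).+1 = hdist x y])
    \/ a != j /\ x \in layer j.
  move=> ak; rewrite inE => xa; move: (yj); rewrite inE => yA.
  have /(geoA xa yA)[z [zA]] : 0 < hdist (hcons a x) (hcons j y).
    by rewrite hdist_cons //; lia.
  rewrite -(hcons_tail z); move: zA; rewrite -{1}(hcons_tail z).
  set c := nat_of_ord _; set t := htail z; have ck : c < k ord0 by apply: ltn_ord.
  rewrite !hdist_cons // => tA xt ty.
  have [ac|ac] := eqVneq a c.
    by left; exists t; rewrite inE ac; split=> //; lia.
  have def_x : x = t by apply: hdist0_eq; lia.
  rewrite -def_x in tA ty; right.
  have cj : c = j by lia.
  by rewrite -cj inE.
case: (step i ik xi) => [[z [zi xz zy]]|[_ xj]].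
  by exists i, z; rewrite eqxx.
case: (step j jk xj) => [[z [zj xz zy]]|[/eqP//]].
by exists j, z; rewrite eqxx orbT.
Qed.

Lemma geodesic_layerU i j : i < k ord0 -> j < k ord0 ->
  geodesic_set (@hdist _ tail_dims) (layer i :|: layer j).
Proof.
move=> ik jk x y; rewrite !in_setU => /orP[] xS /orP[] yS xy.
- have [z [zS xz zy]] := geodesic_layers ik ik xS yS xy; exists z; split=> //.
  by move: zS; rewrite setUid in_setU => ->.
- by have [z] := geodesic_layers ik jk xS yS xy; exists z.
- by have [z] := geodesic_layers jk ik xS yS xy; rewrite setUC; exists z.
- have [z [zS xz zy]] := geodesic_layers jk jk xS yS xy; exists z; split=> //.
  by move: zS; rewrite setUid in_setU => ->; rewrite orbT.
Qed.

(** Otherwise the copies of [x] at height [i] and of [y] at height [j] are at distance 2. Their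
    common neighbours, [y] at height [i] and [x] at height [j], are both outside [A]. *)
Lemma layers_no_edge i j x y : i < k ord0 -> j < k ord0 ->
  x \in layer i :\: layer j -> y \in layer j :\: layer i -> hdist x y != 1.
Proof.
move=> ik jk; rewrite !inE => /andP[xj xi] /andP[yi yj]; apply/eqP => xy.
have ij : i != j by apply: contraNneq xj => <-.
have /(geoA xi yj)[z [zA]] : 0 < hdist (hcons i x) (hcons j y).
  by rewrite hdist_cons //; lia.
rewrite -(hcons_tail z); move: zA; rewrite -{1}(hcons_tail z).
set c := nat_of_ord _; set t := htail z; have ck : c < k ord0 by apply: ltn_ord.
rewrite !hdist_cons // => tA xt ty.
have [ic|ic] := eqVneq i c.
  have def_t : t = y by apply: hdist0_eq; lia.
  by rewrite -def_t ic tA in yi.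
have def_t : x = t by apply: hdist0_eq; lia.
have cj : c = j by move: ty; rewrite -def_t; lia.
by rewrite def_t -cj tA in xj.
Qed.

(** * Consequences of minimality *)

Hypothesis minA : smallest_hamming k (induced A).

Let isoA : isometric_daisy k_gt0 A.
Proof. exact/isometric_daisyP. Qed.

Lemma smallest_factor_gt1 : 1 < k ord0.
Proof.
rewrite ltnNge; apply/negP => k1; case: minA => /(_ _ tail_dims (ltnSn n)) + _.
apply; apply: (realizable_pullback (f := hcons 0)) hcons_zero _ isoA.
  by move=> x y; rewrite hdist_cons // eqxx.
move=> x _; exists (htail x); rewrite -[RHS]hcons_tail; congr hcons.
by have := ltn_ord ((x : hamming_vertex k) ord0); lia.
Qed.

Lemma smallest_layer_neq0 j : j < k ord0 -> layer j != set0.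
Proof.
have k1 := smallest_factor_gt1.
(* The value 0 cannot be deleted in this way, as the zero vertex must be preserved; but layer 0
   contains layer 1, which exists since [1 < k ord0]. *)
have pos_neq0 i : 0 < i -> i < k ord0 -> layer i != set0; last first.
  case: j => [_|j]; last exact: pos_neq0.
  have /set0Pn[x x1] := pos_neq0 1 isT k1.
  by apply/set0Pn; exists x; apply: subsetP x1; apply: layer_sub0.
move=> i_gt0 ik; apply/eqP => i0.
pose h c := if c == ord0 then (k ord0).-1 else k c.
have h_gt0 c : 0 < h c by rewrite /h; case: eqP => // _; lia.
have hk c : h c <= k c by rewrite /h; case: eqP => [->|]; lia.
case: minA => _ /(_ h hk); case; first by exists ord0; rewrite /h eqxx; lia.
(* [bump i] enumerates the values other than [i], and fixes 0 because [i] is positive. *)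
pose skip (y : hamming h) : hamming k := hvertex k_gt0 (fun c =>
  if c == ord0 then bump i ((y : hamming_vertex h) c)
  else (y : hamming_vertex h) c).
have skipE y c : (skip y : hamming_vertex k) c =
    (if c == ord0 then bump i ((y : hamming_vertex h) c)
     else (y : hamming_vertex h) c) :> nat.
  rewrite hvertexE //; have := ltn_ord ((y : hamming_vertex h) c).
  move: (nat_of_ord _) => v.
  by rewrite /h /bump; case: eqP => [->|_]; lia.
apply: (realizable_pullback (h_gt0 := h_gt0) (f := skip)) isoA.
- move=> x y; apply: eq_bigr => c _; rewrite !skipE.
  by case: (c == _) => //; rewrite (inj_eq (can_inj (bumpK _))).
- apply: hvertex_ext => c; rewrite skipE !zero_vertexE /bump.
  by case: eqP => //; lia.
move=> x xA.
have xi : (x : hamming_vertex k) ord0 != i :> nat.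
  apply: contra_eqN i0 => /eqP x0; apply/set0Pn; exists (htail x).
  by rewrite inE -x0 hcons_tail.
exists (hvertex h_gt0 (fun c =>
  if c == ord0 then unbump i ((x : hamming_vertex k) c)
  else (x : hamming_vertex k) c)).
apply: hvertex_ext => c; rewrite skipE hvertexE.
  by case: eqP => // c0; rewrite c0 unbumpKcond (negPf xi).
have := ltn_ord ((x : hamming_vertex k) c); rewrite /h /unbump.
by case: eqP => [->|//]; move: xi; lia.
Qed.

End Layers.

(** * Construction of the expansion *)

Theorem theorem3p7 (n : nat) (k : 'I_n.+1 -> nat) (k_gt0 : forall i, 0 < k i)
    (A : {set hamming k}) :
  isometric_daisy k_gt0 A ->
  smallest_hamming k (induced A) ->
  exists (k' : 'I_n -> nat) (k'_gt0 : forall i, 0 < k' i)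
         (A' : {set hamming k'}),
    [/\ hamming_daisy k'_gt0 A',
        iso_to_subgraph (induced A') (induced A) &
        exists (l : nat) (W : 'I_l.+1 -> {set induced A'}),
          [/\ 0 < l,
              daisy_peripheral_expansion k'_gt0 W &
              iso (induced A) (expansion W)]].
Proof.
move=> /isometric_daisyP[starA geoA] minA.
have k1 := smallest_factor_gt1 starA geoA minA.
have layer_neq0 := smallest_layer_neq0 starA geoA minA.
pose A' := layer k_gt0 A 0; pose dist := @hdist _ (tail_dims k).
have daisy_layer j : j < k ord0 ->
    hamming_daisy (tail_dims_gt0 k_gt0) (layer k_gt0 A j).
  move=> jk; apply/(daisy_star_closed (@hdist_metric _ _)).
  exact: layer_star_closed.
have geoU := geodesic_layerU (k_gt0 := k_gt0) geoA.
have geoA' : geodesic_set dist A' by rewrite -[A']setUid; apply: geoU.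
exists (tail_dims k), (tail_dims_gt0 k_gt0), A'; split; first exact: daisy_layer.
  (* [A'] embeds into [A] as its bottom layer; the subgraph is the one induced on the image. *)
  have inA (x : induced A') : hcons k_gt0 0 (val x) \in A.
    by have := valP x; rewrite inE.
  pose f (x : induced A') : induced A := exist _ (hcons k_gt0 0 (val x)) (inA x).
  have f_inj : injective f.
    move=> x y [fxy]; apply/val_inj/hdist0_eq.
    have := hdist_cons k_gt0 (val x) (val y) (k_gt0 ord0) (k_gt0 ord0).
    by rewrite fxy hdistxx eqxx.
  pose e : rel (induced A) :=
    fun x y => [&& x \in f @: setT, y \in f @: setT & adj x y].
  have e_sym : symmetric e by move=> x y; rewrite /e adj_sym andbCA.
  have eP x y : e x y -> [/\ x \in f @: setT, y \in f @: setT & adj x y].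
    by case/and3P.
  exists (Subgraph e_sym eP).
  have imf x : f x \in f @: setT by apply: imset_f.
  exists (fun x => exist _ (f x) (imf x)).
    apply: inj_surj_bij => [x y [fxy]|[_ /= /[dup] /imsetP[x _ ->] fx]].
      by apply: f_inj; apply: val_inj.
    by exists x; apply: val_inj.
  move=> x y; rewrite /= /subgraph_adj /= /e !imf /= /induced_adj /=.
  by rewrite !hdist_adj hdist_cons // eqxx.
(* One index for each value of the first coordinate, so that [W ord0] is the bottom layer, that is,
   all of [A']. *)
pose l := (k ord0).-1; have lK : l.+1 = k ord0 by rewrite /l; lia.
have lt_k (i : 'I_l.+1) : i < k ord0 by rewrite -lK.
pose W (i : 'I_l.+1) : {set induced A'} :=
  [set x | val x \in layer k_gt0 A i].
have valW i : val @: W i = layer k_gt0 A i.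
  apply/setP => x; apply/imsetP/idP => [[y + ->]|xi]; first by rewrite inE.
  have xA' : x \in A' by apply: subsetP xi; apply: layer_sub0.
  by exists (exist _ x xA') => //; rewrite inE.
exists l, W; split; first by rewrite /l; lia.
  split; first exact: daisy_layer.
  - have isoWU i j : isometric (W i :|: W j).
      apply: isometric_in_induced (@hdist_metric _ _) geoA' _.
      by rewrite imsetU !valW; apply: geoU.
    split=> [|i j _||i j x y xi yj|i|//].
    + exact: gm_connected (gm_induced (@hdist_metric _ _) geoA').
    (* The zero vertex lies in every layer, since each layer is nonempty and star-closed. *)
    + pose o : hamming (tail_dims k) := zero_vertex (tail_dims_gt0 k_gt0).
      have oW (c : 'I_l.+1) : o \in layer k_gt0 A c.
        have /set0Pn[v vc] := layer_neq0 c (lt_k c).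
        by apply: (layer_star_closed starA (lt_k c) vc); rewrite hdistxx.
      apply/set0Pn; exists (exist _ o (oW ord0)).
      by rewrite !inE; have := oW i; have := oW j; rewrite !inE => -> ->.
    + apply/setP => x; rewrite inE; apply/bigcupP; exists ord0 => //.
      by rewrite inE; apply: valP.
    + rewrite /= /induced_adj /= hdist_adj.
      apply: (layers_no_edge geoA (lt_k i) (lt_k j)).
        by move: xi; rewrite !in_setD !inE.
      by move: yj; rewrite !in_setD !inE.
    + by rewrite -[W i]setUid; apply: isoWU.
  - by apply/setP => x; rewrite in_setT inE; apply: valP.
  - by move=> i _; rewrite valW; apply: daisy_layer.
apply: iso_sym.
have inA (p : expansion W) : hcons k_gt0 (val p).2 (val (val p).1) \in A.
  by have := valP p; rewrite !inE.
(* The copy of [x] with index [i] becomes the vertex with first coordinate [i] and tail [x]. *)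
exists (fun p : expansion W =>
  exist _ (hcons k_gt0 (val p).2 (val (val p).1)) (inA p) : induced A).
  apply: inj_surj_bij => [[[x i] xi] [[y j] yj] [] /= xy|x].
    have := hdist_cons k_gt0 (val x) (val y) (lt_k i) (lt_k j).
    rewrite xy hdistxx => /esym/eqP; rewrite addn_eq0 eqb0 negbK.
    case/andP=> /eqP/val_inj ij /eqP/hdist0_eq/val_inj x_y.
    by apply: val_inj; rewrite /= ij x_y.
  have xl : htail (val x) \in layer k_gt0 A ((val x : hamming_vertex k) ord0).
    by rewrite inE hcons_tail (valP x).
  have xA' : htail (val x) \in A'.
    by apply: subsetP xl; apply: layer_sub0.
  have x0l : (val x : hamming_vertex k) ord0 < l.+1 by rewrite lK.
  pose p : induced A' * 'I_l.+1 := (exist _ (htail (val x)) xA', Ordinal x0l).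
  have pW : p.1 \in W p.2 by rewrite inE.
  by exists (exist _ p pW); apply: val_inj; rewrite /= hcons_tail.
move=> [[x i] xi] [[y j] yj].
rewrite /= /induced_adj /expansion_adj /= /induced_adj !hdist_adj hdist_cons //.
(* The distance [(i != j) + hdist x y] is 1 exactly when the heights differ over equal tails, or
   agree over adjacent tails: the two kinds of edges of the expansion. *)
have -> : (x == y) = (hdist (val x) (val y) == 0).
  by apply/eqP/eqP => [->|/hdist0_eq/val_inj//]; rewrite hdistxx.
have -> : ((i : nat) == j) = (i == j) by [].
by case: (i == j); rewrite /= ?andbF ?andbT ?orbF ?add1n.
Qed.
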